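(* Let $\alpha>0$, $n\in\mathbb{N}$ with $n\ge1$, and let $\theta_1,\theta_2$ be independent non-negative random variables with distributions $\mu_1,\mu_2$. Let $Q_1,\dots,Q_{2n}$ be i.i.d. random variables with the Pareto distribution $\pi_\alpha$ and $W_1,\dots,W_n$ i.i.d. random variables with the distribution $\mathrm{pow}(\alpha)$, such that $\theta_1,\theta_2,Q_1,\dots,Q_{2n},W_1,\dots,W_n$ are independent. Then $\mu_1\vartriangle_{\alpha,n}\mu_2$ is the distribution of the random variable $$M(\theta_1,\theta_2)\sum_{k=0}^n Q_{k:n+k}\,\mathbf{1}_{(W_{k:n},\,W_{k+1:n}]}\bigl(\varrho(\theta_1,\theta_2)\bigr),$$ where $Q_{0:n}:=1$, $W_{0:n}:=-\infty$ and $W_{n+1:n}:=\infty$.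
   Context: $\mathcal{P}_+$ is the set of Borel probability measures on $[0,\infty)$; $T_a\mu$ ($a\ge0$) is the law of $aX$ when $X\sim\mu$. $\pi_\alpha$ is the Pareto distribution with density $\alpha t^{-\alpha-1}$ on $[1,\infty)$; $\mathrm{pow}(\alpha)$ is the distribution with density $\alpha x^{\alpha-1}\mathbf{1}_{[0,1]}(x)$. $X_{k:m}$ denotes the $k$-th order statistic ($k$-th smallest value) of $X_1,\dots,X_m$, $1\le k\le m$; thus $Q_{k:n+k}$ is the $k$-th smallest among $Q_1,\dots,Q_{n+k}$ and $W_{k:n}$ the $k$-th smallest among $W_1,\dots,W_n$. $M(\theta_1,\theta_2)=\max\{\theta_1,\theta_2\}$ and $\varrho(\theta_1,\theta_2)=\min\{\theta_1,\theta_2\}/\max\{\theta_1,\theta_2\}$ (with $\varrho:=0$ when $\theta_1=\theta_2=0$). The Kucharczak–Urbanik convolution $\vartriangle_{\alpha,n}$ is the binary operation on $\mathcal{P}_+$ defined as follows. For $x\in[0,1]$, $$\delta_x\vartriangle_{\alpha,n}\delta_1=(1-x^\alpha)^n\,\delta_1+\sum_{k=1}^n\binom{n}{k}x^{\alpha k}(1-x^\alpha)^{n-k}\mu_{k,n},$$ where $\mu_{k,n}$ is the probability measure with density $$f_{k,n}(s)=\alpha k\binom{n+k}{n}s^{-\alpha(n+1)-1}\bigl(1-s^{-\alpha}\bigr)^{k-1},\qquad s>1.$$ For $a,b\ge0$ with $M=\max\{a,b\}$, $m=\min\{a,b\}$, $\delta_a\vartriangle_{\alpha,n}\delta_b=T_M(\delta_{m/M}\vartriangle_{\alpha,n}\delta_1)$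 if $M>0$, and $\delta_0\vartriangle_{\alpha,n}\delta_0=\delta_0$. In general $\mu_1\vartriangle_{\alpha,n}\mu_2=\int_0^\infty\int_0^\infty(\delta_a\vartriangle_{\alpha,n}\delta_b)\,\mu_1(da)\,\mu_2(db)$. *)

(* Defs.v *)
From HB Require Import structures.
From mathcomp Require Import all_boot all_order all_algebra.
From mathcomp Require Import all_classical all_reals all_analysis.

Set Implicit Arguments.
Unset Strict Implicit.
Unset Printing Implicit Defensive.

Import Order.TTheory GRing.Theory Num.Theory.
Import numFieldNormedType.Exports.

Local Open Scope classical_set_scope.
Local Open Scope ring_scope.
Local Open Scope ereal_scope.

Section Laws.
Context {R : realType}.

Definition density_law (f : R -> R) (D : set R) (A : set R) : \bar R :=
  \int[lebesgue_measure]_(t in A `&` D) (f t)%:E.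

Definition pareto_law (alpha : R) : set R -> \bar R :=
  density_law (fun t => alpha * t `^ (- alpha - 1))%R `[1%R, +oo[%classic.

Definition pow_law (alpha : R) : set R -> \bar R :=
  density_law (fun x => alpha * x `^ (alpha - 1))%R `[0%R, 1%R]%classic.

(* Borel probability measures on [0, +oo[ are represented by the Borel
   probability measures on R that are carried by [0, +oo[. *)
Definition nonneg_law (mu : probability R R) : Prop := mu `]-oo, 0%R[%classic = 0.

End Laws.

Section KucharczakUrbanik.
Context {R : realType}.
Variables (alpha : R) (n : nat).

Definition ku_density (k : nat) (s : R) : R :=
  (alpha * k%:R * 'C(n + k, n)%:R * s `^ (- alpha * n.+1%:R - 1)
   * (1 - s `^ (- alpha)) ^+ k.-1)%R.

Definition ku_mu (k : nat) : set R -> \bar R :=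
  density_law (ku_density k) `]1%R, +oo[%classic.

Definition ku_delta1 (x : R) (A : set R) : \bar R :=
  ((1 - x `^ alpha) ^+ n)%:E * \d_(1%R : R) A
  + \sum_(1 <= k < n.+1)
      ('C(n, k)%:R * x `^ (alpha * k%:R) * (1 - x `^ alpha) ^+ (n - k))%:E
      * ku_mu k A.

Definition ku_delta (a b : R) : set R -> \bar R :=
  let M := Num.max a b in
  let m := Num.min a b in
  if (0 < M)%R then pushforward (ku_delta1 (m / M)) (fun x : R => M * x)%R
  else \d_(0%R : R).

Definition ku_conv (mu1 mu2 : probability R R) (A : set R) : \bar R :=
  \int[mu1]_(a in `[0%R, +oo[) \int[mu2]_(b in `[0%R, +oo[) ku_delta a b A.

End KucharczakUrbanik.

Section Independence.
Context d {T : measurableType d} {R : realType}.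

Definition has_law (P : probability T R) (X : T -> R) (nu : set R -> \bar R) :=
  measurable_fun [set: T] X /\
  forall A : set R, measurable A -> pushforward P X A = nu A.

Definition mutually_independent (P : probability T R) (I : finType)
    (X : I -> {RV P >-> R}) : Prop :=
  forall (J : {set I}) (B : I -> set R), (forall i, measurable (B i)) ->
    P (\bigcap_(i in [set` J]) X i @^-1` B i)
    = \prod_(i in J) P (X i @^-1` B i).

Definition ku_family (P : probability T R) (p q : nat)
    (theta1 theta2 : {RV P >-> R})
    (Q : 'I_p -> {RV P >-> R}) (W : 'I_q -> {RV P >-> R})
    (i : bool + ('I_p + 'I_q)) : {RV P >-> R} :=
  match i with
  | inl b => if b then theta2 else theta1
  | inr (inl j) => Q j
  | inr (inr j) => W j
  end.

End Independence.

Section OrderStatistics.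
Context {R : realType}.

(* The k-th smallest entry of s, meaningful for 1 <= k <= size s. *)
Definition order_stat (s : seq R) (k : nat) : R := (sort <=%R s)`_k.-1.

(* Q_{k:m} for the first m of the variables Q_1, ..., Q_p, with Q_{0:m} := 1. *)
Definition Q_stat (p : nat) (Q : 'I_p -> R) (k m : nat) : R :=
  if k == 0%N then 1%R
  else order_stat (take m [seq Q i | i <- enum 'I_p]) k.

Definition W_stat (n : nat) (W : 'I_n -> R) (k : nat) : \bar R :=
  if k == 0%N then -oo
  else if (k <= n)%N then (order_stat [seq W i | i <- enum 'I_n] k)%:E
  else +oo.

(* At a = b = 0 this is 0 / 0 = 0. *)
Definition min_max_ratio (a b : R) : R := (Num.min a b / Num.max a b)%R.

Definition ku_value (n : nat) (a b : R) (Q : 'I_(2 * n) -> R) (W : 'I_n -> R)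
    : R :=
  (Num.max a b *
   \sum_(k < n.+1) Q_stat Q k (n + k) *
     \1_(`](W_stat W k), (W_stat W k.+1)]%classic : set (\bar R))
       (min_max_ratio a b)%:E)%R.

End OrderStatistics.

(* Main.v *)
(* N := #{j | W_j < rho} is, for fixed theta's, binomial with success
   probability rho ^ alpha, and rho lies in (W_{k:n}, W_{k+1:n}] exactly when
   N = k, so the value is M * Q_{N:n+N}. The event {Q_{k:n+k} < y} says that at
   least k of the n + k Pareto variables are below y; the derivative of this
   binomial tail telescopes to the density of mu_{k,n}. Hence for fixed theta's
   the value has law delta_a triangle delta_b, and Fubini's theorem applied to
   theta_1, then to theta_2, integrates this over mu_1 and mu_2. *)
Require Import Defs.
From HB Require Import structures.
From mathcomp Require Import all_boot all_order all_algebra.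
From mathcomp Require Import all_classical all_reals all_analysis.
From mathcomp Require Import measurable_realfun ring.

Set Implicit Arguments.
Unset Strict Implicit.
Unset Printing Implicit Defensive.

Import Order.TTheory GRing.Theory Num.Theory.
Import numFieldNormedType.Exports.

Local Open Scope classical_set_scope.
Local Open Scope ring_scope.

(** * Bernstein polynomials, and order statistics of a list through counts *)

(** In the success probability, the sum is the tail of a binomial law with [m] trials. Its
    derivative is the density of the [k]-th order statistic of [m] uniform variables on [0, 1]. *)
Lemma deriv_bernstein_tail (R : comNzRingType) (m k : nat) : (0 < k <= m)%N ->
  deriv (\sum_(k <= j < m.+1) ('X^j * (1 - 'X) ^+ (m - j)) *+ 'C(m, j))
  = ('X^(k.-1) * (1 - 'X) ^+ (m - k)) *+ (k * 'C(m, k)) :> {poly R}.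
Proof.
move=> /andP[k0 km].
(* The j-th Bernstein term has derivative c j - c j.+1. *)
pose c j : {poly R} := ('X^(j.-1) * (1 - 'X) ^+ (m - j)) *+ (j * 'C(m, j)).
rewrite raddf_sum (eq_big_nat _ _ (F2 := fun j => - (c j.+1 - c j))) /=; last first.
  move=> [|j] /andP[kj jm]; first by rewrite leqn0 in kj; rewrite (eqP kj) in k0.
  rewrite derivMn derivM derivXn deriv_exp derivB derivX derivC sub0r mulNr mul1r.
  (* [mul_bin_left] rewrites the coefficient of the next term [c], so that both terms carry the same
     binomial coefficient. *)
  rewrite opprB /c /= (mul_bin_left m j.+1) -subnS !mulrnAl !mulrnAr mulrN.
  by rewrite mulNrn mulrnDl mulNrn -!mulrnA mulnC.
rewrite sumrN telescope_sumr; last exact: leqW.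
(* The upper boundary term [c m.+1] vanishes because ['C(m, m.+1)] does. *)
by rewrite /c bin_small// muln0 mulr0n sub0r opprK.
Qed.

(** The entries below [y] form a prefix of a sorted list, and the count is the length of this
    prefix. *)
Lemma sorted_nth_count (R : realType) (y : R) (s : seq R) (k : nat) :
  sorted <=%R s -> (k < size s)%N -> (s`_k < y) = (k < count (< y) s)%N.
Proof.
elim: s k => [|a s IH] [|k] //= sas.
  move=> _; have [//|ya] := ltP a y; rewrite add0n; apply/esym/negbTE.
  rewrite -has_count; apply/hasPn => x xs.
  by rewrite -leNgt (le_trans ya)// (allP (order_path_min le_trans sas)).
rewrite ltnS => ks; rewrite (IH _ (path_sorted sas) ks).
have [//|ya] := ltP a y; rewrite add0n.
have -> : count (< y) s = 0%N.
  apply/eqP; rewrite -leqn0 leqNgt -has_count; apply/hasPn => x xs.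
  by rewrite -leNgt (le_trans ya)// (allP (order_path_min le_trans sas)).
by rewrite !ltn0.
Qed.

(** Sorting permutes the list and so preserves counts. Through this equivalence, events about order
    statistics become counting events. *)
Lemma order_stat_lt (R : realType) (y : R) (s : seq R) (k : nat) :
  (0 < k <= size s)%N -> (order_stat s k < y) = (k <= count (< y) s)%N.
Proof.
case: k => [//|k] /= ks.
rewrite /order_stat sorted_nth_count ?size_sort ?sort_le_sorted//.
by rewrite (permP (permEl (perm_sort _ _))).
Qed.

Lemma count_map_card (I : finType) (T : Type) (f : I -> T) (p : pred T)
    (s : seq I) : uniq s ->
  count p (map f s) = #|[set i in s | p (f i)]%SET|.
Proof.
move=> us; rewrite count_map -size_filter -(card_uniqP _) ?filter_uniq//.
by apply: eq_card => i; rewrite !inE mem_filter andbC.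
Qed.

Local Open Scope ereal_scope.

(** * Independence of the sigma-algebras generated by disjoint subfamilies *)

Section Independence.
Context d (T : measurableType d) (R : realType) (P : probability T R).

(** As functions of [B], the two sides are finite measures: [P] restricted to [A], and [P] scaled by
    [P A]. They agree on a pi-system containing the whole space, hence on the sigma-algebra it
    generates. *)
Lemma indep_pi_system (A : set T) (G : set (set T)) :
  measurable A -> G `<=` measurable -> setI_closed G -> G setT ->
  (forall B, G B -> P (A `&` B) = P A * P B) ->
  forall B, <<s G >> B -> P (A `&` B) = P A * P B.
Proof.
move=> mA mG IG GT PG B sB.
have PA0 : (0 <= fine (P A))%R by exact: fine_ge0.
pose m2 : {measure set T -> \bar R} := mscale (NngNum PA0) P.
have m2E C : m2 C = P A * P C.
  by rewrite /m2/= /mscale/= fineK// fin_num_measure.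
pose m1 : {measure set T -> \bar R} := mrestr P mA.
have m1E C : m1 C = P (A `&` C) by rewrite /m1/= /mrestr setIC.
rewrite -m1E -m2E; apply: (g_sigma_algebra_measure_unique G mG (fun=> setT)) => //.
- by rewrite bigcup_const.
- by move=> C GC; rewrite m1E m2E PG.
- by move=> _; rewrite m1E setIT (le_lt_trans (probability_le1 _ mA)) ?ltry.
Qed.

Variables (I : finType) (X : I -> {RV P >-> R}).

Definition cylinders (K : {set I}) : set (set T) :=
  [set E | exists2 B : I -> set R, (forall i, measurable (B i)) &
    E = \bigcap_(i in [set` K]) X i @^-1` B i].

Lemma cylinders_measurable K : cylinders K `<=` measurable.
Proof.
move=> _ [B mB ->]; apply: fin_bigcap_measurable => // i _.
exact: measurable_funPTI.
Qed.

Lemma cylinders_setI K : setI_closed (cylinders K).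
Proof.
move=> _ _ [B mB ->] [C mC ->]; exists (fun i => B i `&` C i).
  by move=> i; exact: measurableI.
by rewrite -bigcapI; apply: eq_bigcapr => i _; rewrite preimage_setI.
Qed.

Lemma cylinders_setT K : cylinders K setT.
Proof.
exists (fun=> setT) => //; apply/esym/seteqP; split => // w _ i _ //.
Qed.

(* The sample space T itself, with the sigma-algebra of (X i)_{i in K}: the
   identity of T then plays the role of the random vector (X i)_{i in K}. *)
Definition cylinderType (K : {set I}) := g_sigma_algebraType (cylinders K).

Lemma cylinder_sub K (A : set (cylinderType K)) :
  measurable A -> d.-measurable (A : set T).
Proof.
apply: smallest_sub; first exact: sigma_algebra_measurable.
exact: cylinders_measurable.
Qed.

Lemma cylinder_measurable_id K :
  measurable_fun setT (id : T -> cylinderType K).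
Proof. by move=> _ A mA; rewrite setTI; exact: (cylinder_sub mA). Qed.

Lemma cylinder_measurable_fun (K : {set I}) i : i \in K ->
  measurable_fun setT (X i : cylinderType K -> R).
Proof.
move=> iK _ A mA; rewrite setTI; apply: sub_sigma_algebra.
exists (fun j => if j == i then A else setT) => [j|]; first by case: ifP.
apply/seteqP; split => [w Aw j _ /=|w /(_ i iK)/=]; last by rewrite eqxx.
by case: eqP => [->|].
Qed.

Hypothesis indX : mutually_independent X.

(** The pi-system argument is used twice, first to replace [A] by a cylinder over [K], then to
    replace [B] by one over [L]. For two cylinders the claim is the product formula over [K], [L]
    and their union. *)
Lemma indep_cylinders (K L : {set I}) (A : set (cylinderType K))
    (B : set (cylinderType L)) : [disjoint K & L]%B ->
  measurable A -> measurable B -> P ((A : set T) `&` B) = P A * P B.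
Proof.
move=> KL mA mB.
have mB' := cylinder_sub mB.
rewrite setIC muleC; apply: (indep_pi_system mB' _ _ _ _ mA).
- exact: cylinders_measurable.
- exact: cylinders_setI.
- exact: cylinders_setT.
move=> C CC; rewrite setIC muleC.
have mC := cylinders_measurable CC; apply: (indep_pi_system mC _ _ _ _ mB).
- exact: cylinders_measurable.
- exact: cylinders_setI.
- exact: cylinders_setT.
move=> D [D' mD' ->]; case: CC => [C' mC' ->].
(* A single family of Borel sets serves both cylinders: since [K] and [L] are disjoint, [F] agrees
   with [D'] on [L]. *)
pose F i := if i \in K then C' i else D' i.
have FK : \bigcap_(i in [set` K]) X i @^-1` C' i
        = \bigcap_(i in [set` K]) X i @^-1` F i.
  by apply: eq_bigcapr => i /= iK; rewrite /F iK.
have FL : \bigcap_(i in [set` L]) X i @^-1` D' i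
        = \bigcap_(i in [set` L]) X i @^-1` F i.
  by apply: eq_bigcapr => i /= iL; rewrite /F (disjointFl KL iL).
have mF i : measurable (F i) by rewrite /F; case: ifP.
rewrite FK FL -bigcap_setU !indX//.
have := indX (K :|: L)%SET mF.
rewrite (eq_bigl [in [predU K & L]]) => [|i]; last by rewrite !inE.
rewrite bigU//= => <-; rewrite (_ : [set` K :|: L] = [set` K] `|` [set` L])//.
by rewrite predeqE => i /=; rewrite inE; exact: iff_sym (rwP orP).
Qed.
End Independence.

(** * Freezing one independent variable, and the binomial law of a count *)

Section CountLaw.
Context d (T : measurableType d) (R : realType) (P : probability T R).
Variables (I : finType) (X : I -> {RV P >-> R}).
Hypothesis indX : mutually_independent X.

(** The joint law of [X i] and of the identity into [cylinderType X K] is a product measure, so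
    [X i] can be frozen at [a] while the variables indexed by [K] stay random. Measurability in [a]
    is recorded because later changes of the integration domain require it. *)
Lemma fubini_cylinders (K : {set I}) (i : I) (mu : probability R R)
    (C : set (R * cylinderType X K)) :
  i \notin K -> has_law P (X i) mu -> measurable C ->
  measurable_fun [set: R] (fun a => P [set w | C (a, w)]) /\
  P [set w | C (X i w, w)] = \int[mu]_a P [set w | C (a, w)].
Proof.
move=> iK [mX Xmu] mC.
have mV := @cylinder_measurable_id _ _ _ _ _ X K.
pose V : {mfun T >-> cylinderType X K} := mfun_Sub (mem_set mV).
have mU : measurable_fun setT (fun w => (X i w, V w)).
  exact: measurable_fun_pair.
pose U : {mfun T >-> (R * cylinderType X K)%type} := mfun_Sub (mem_set mU).
have VE a : P [set w | C (a, w)] = distribution P V (xsection C a).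
  by rewrite /distribution /pushforward xsectionE.
split.
  by under eq_fun do rewrite VE; exact: measurable_fun_xsection.
under eq_integral do rewrite VE.
transitivity (distribution P U C); first by [].
(* The integral of the section probabilities is the product measure by definition. It remains to
   compare it with the joint law on rectangles. *)
rewrite -[RHS]/((mu \x distribution P V) C); apply/esym.
apply: product_measure_unique => // A B mA mB.
have mi := cylinder_measurable_fun (set11 i).
transitivity (P (X i @^-1` A `&` B)); first by [].
rewrite (indep_cylinders indX (K := [set i]%SET) (L := K)) //.
- by congr (_ * _); exact: Xmu.
- by rewrite disjoints1.
- by rewrite -[X in measurable X]setTI; exact: mi.
Qed.

(** The event is split according to the exact set [A] of successful indices. By independence each
    piece has probability [p ^+ k * (1 - p) ^+ (#|J| - k)], and there are ['C(#|J|, k)] such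
    sets. *)
Lemma prob_card_eq (J : {set I}) (b : pred R) (p : R) (k : nat) :
  measurable [set x | b x] ->
  (forall i, i \in J -> P (X i @^-1` [set x | b x]) = p%:E) ->
  P [set w | #|[set i in J | b (X i w)]%SET| = k]
  = ('C(#|J|, k)%:R * p ^+ k * (1 - p) ^+ (#|J| - k))%:E.
Proof.
move=> mb Pb.
pose B (A : {set I}) i := if i \in A then [set x | b x] else ~` [set x | b x].
have mB A i : measurable (B A i).
  by rewrite /B; case: ifP => // _; exact: measurableC.
pose F A := \bigcap_(i in [set` J]) X i @^-1` B A i.
have FE (A : {set I}) w : A \subset J -> F A w <-> [set i in J | b (X i w)]%SET = A.
  move=> AJ; split=> [FA|<- i /= iJ]; last first.
    by rewrite /B !inE (iJ : i \in J); case: ifPn => //= /negP.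
  apply/setP => i; rewrite !inE; have [iJ|iJ] /= := boolP (i \in J).
    by have := FA i iJ; rewrite /B /=; case: ifP => // _ /= /negP/negbTE.
  by apply/esym/negP => /(fintype.subsetP AJ); exact/negP.
pose D := [set A : {set I} | A \subset J & #|A| == k]%SET.
have -> : [set w | #|[set i in J | b (X i w)]%SET| = k]
    = \bigcup_(A in [set` enum D]) F A.
  apply/seteqP; split=> [w /= wk|w [A /=]].
    exists [set i in J | b (X i w)]%SET.
      rewrite /= mem_enum !inE wk eqxx andbT.
      by apply/fintype.subsetP => i; rewrite !inE => /andP[].
    by apply/FE => //; apply/fintype.subsetP => i; rewrite !inE => /andP[].
  by rewrite mem_enum !inE => /andP[AJ /eqP <-] /(FE _ _ AJ) ->.
rewrite measure_fin_bigcup//=; last 2 first.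
- move=> A A' /=; rewrite !mem_enum !inE => /andP[AJ _] /andP[AJ' _].
  by move=> [w [/(FE _ _ AJ) <- /(FE _ _ AJ')]].
- by move=> A _; apply: fin_bigcap_measurable => // i _; exact: measurable_funPTI.
rewrite -fsbig_seq ?enum_uniq// big_enum/=.
rewrite (eq_bigr (fun=> (p ^+ k * (1 - p) ^+ (#|J| - k))%:E)) => [|A].
  by rewrite sumEFin sumr_const cards_draws -mulrA mulr_natl.
rewrite inE => /andP[AJ /eqP Ak].
rewrite /F indX//.
rewrite (eq_bigr (fun i => (if i \in A then p else 1 - p)%R%:E)) => [|i iJ].
  rewrite prodEFin (big_setID A)/= (finset.setIidPr AJ).
  rewrite (eq_bigr (fun=> p)) => [|i ->//]; rewrite prodr_const Ak.
  rewrite (eq_bigr (fun=> 1 - p)%R) => [|i]; last first.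
    by rewrite inE => /andP[/negbTE ->].
  by rewrite prodr_const cardsD (finset.setIidPr AJ) Ak.
rewrite /B; case: ifP => _; first exact: Pb.
rewrite -preimage_setC probability_setC ?(Pb _ iJ)//.
by rewrite -[X in measurable X]setTI; exact: measurable_funP.
Qed.

End CountLaw.

(** * Distribution functions of the Pareto, power and [ku_mu] laws *)

Section PowerIntegrals.
Context (R : realType).
Implicit Types (f F : R -> R) (a b x y : R).

(** A nonnegative density defines a measure, and the open left rays form a pi-system generating the
    Borel sets. The rays []-oo, k[] exhaust the line, and their finite mass is read off from the
    probability [m]. *)
Lemma density_law_unique f (D : set R) (m : probability R R) :
  measurable D -> measurable_fun D f -> (forall x, D x -> (0 <= f x)%R) ->
  (forall y, m `]-oo, y[%classic = density_law f D `]-oo, y[%classic) ->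
  forall A, measurable A -> m A = density_law f D A.
Proof.
move=> mD mf f0 mfE.
have nu0 : density_law f D set0 = 0 by rewrite /density_law set0I integral_set0.
have nu_ge0 A : 0 <= density_law f D A.
  by apply: integral_ge0 => x [_ Dx]; rewrite lee_fin f0.
have nu_sa : semi_sigma_additive (density_law f D).
  move=> G mG tG mUG.
  rewrite [X in _ --> X](_ : _ = \sum_(i <oo) density_law f D (G i)).
    by apply/cvg_closeP; split; [exact: is_cvg_nneseries|rewrite closeE].
  rewrite /density_law setI_bigcupl ge0_integral_bigcup//.
  - by move=> k; exact: (measurableI _ _ (mG k) mD).
  - apply/measurable_EFinP; apply: measurable_funS mf => //.
    by rewrite -setI_bigcupl; exact: subIsetr.
  - by move=> x; rewrite -setI_bigcupl => -[_ Dx]; rewrite lee_fin f0.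
  - exact: trivIset_setIr.
pose nu : {measure set R -> \bar R} :=
  HB.pack (density_law f D) (isMeasure.Build _ _ _ _ nu0 nu_ge0 nu_sa).
move=> A mA; rewrite -[RHS]/(nu A).
apply: (@measure_unique _ R R (@RGenInftyO.G R) (fun k => `]-oo, k%:R[%classic)
  _ _ _ _ m nu) => //.
- exact: RGenInftyO.measurableE.
- move=> _ _ [x ->] [y ->]; exists (Num.min x y); apply/seteqP.
  by split=> z /=; rewrite !in_itv/= lt_min; [move=> [-> ->]|move=> /andP[]].
- by move=> k; exists k%:R.
- rewrite -subTset => x _; exists (Num.truncn x).+1 => //=.
  by rewrite in_itv/= truncnS_gt.
- by move=> _ [y ->]; exact: mfE.
- by move=> k; rewrite (le_lt_trans (probability_le1 _ _))// ltry.
Qed.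

Lemma continuous_powR (p x : R) : (0 < x)%R -> {for x, continuous (@powR R ^~ p)}.
Proof.
move=> x0; apply: differentiable_continuous; apply/derivable1_diffP.
by apply: ex_derive; exact: is_derive1_powR.
Qed.

(** The fundamental theorem of calculus, arranged for real powers, whose derivative formula holds at
    positive points. *)
Lemma integral_is_derive f F a b : (0 < a)%R -> (a < b)%R ->
  (forall x, (0 < x)%R -> is_derive x 1%R F (f x)) ->
  (forall x, (0 < x)%R -> {for x, continuous f}) ->
  \int[lebesgue_measure]_(x in `[a, b]) (f x)%:E = (F b - F a)%:E.
Proof.
move=> a0 ab dF cf; rewrite (@continuous_FTC2 _ _ F)//.
- apply: continuous_in_subspaceT => x; rewrite inE/= in_itv/= => /andP[ax _].
  exact/cf/lt_le_trans/ax.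
- have cF x : (0 < x)%R -> {for x, continuous F}.
    move=> x0; apply: differentiable_continuous; apply/derivable1_diffP.
    by have [] := dF _ x0.
  split.
  + move=> x; rewrite in_itv/= => /andP[ax _].
    by have [] := dF _ (lt_trans a0 ax).
  + exact/cvg_at_right_filter/cF.
  + exact/cvg_at_left_filter/cF/(lt_trans a0).
- move=> x; rewrite in_itv/= => /andP[ax _]; rewrite derive1E.
  by have [_] := dF _ (lt_trans a0 ax).
Qed.

(** The Boolean [b] covers both the closed support of [pareto_law] and the open support of
    [ku_mu]. *)
Lemma ray_lt y (b : bool) : `]-oo, y[%classic `&`
  [set` Interval (BSide b 1%R) +oo%O] = [set` Interval (BSide b 1%R) (BLeft y)].
Proof.
apply/seteqP; split=> x /=; rewrite !in_itv/= andbT.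
- by move=> [-> ->].
- by move=> /andP[-> ->].
Qed.

Variable alpha : R.
Hypothesis alpha_gt0 : (0 < alpha)%R.

Lemma pareto_law_lt y : (1 < y)%R ->
  pareto_law alpha `]-oo, y[%classic = (1 - y `^ (- alpha))%:E.
Proof.
move=> y1; pose F s : R := (- s `^ (- alpha))%R.
pose f s : R := (alpha * s `^ (- alpha - 1))%R.
have dF (x : R) : (0 < x)%R -> is_derive x 1%R F (f x).
  move=> x0; have := is_deriveN (is_derive1_powR (- alpha) x0).
  by rewrite mulNr opprK.
have cf (x : R) : (0 < x)%R -> {for x, continuous f}.
  move=> x0; apply: (@continuousM _ R^o (cst alpha)); first exact: cst_continuous.
  exact: continuous_powR.
rewrite /pareto_law /density_law ray_lt integral_itv_bndo_bndc; last first.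
  apply/measurable_EFinP/measurable_funTS; apply: measurable_funM => //.
rewrite (integral_is_derive ltr01 y1 dF cf) /F powR1 opprK addrC//.
Qed.

Lemma pareto_law_le1 y : (y <= 1)%R -> pareto_law alpha `]-oo, y[%classic = 0.
Proof.
move=> y1; rewrite /pareto_law /density_law ray_lt set_itv_ge ?integral_set0//.
by rewrite bnd_simp -leNgt.
Qed.

Lemma pow_law_ge x : (0 < x <= 1)%R ->
  pow_law alpha `[x, +oo[%classic = (1 - x `^ alpha)%:E.
Proof.
move=> /andP[x0 x1]; pose f s : R := (alpha * s `^ (alpha - 1))%R.
have cf (s : R) : (0 < s)%R -> {for s, continuous f}.
  move=> s0; apply: (@continuousM _ R^o (cst alpha)); first exact: cst_continuous.
  exact: continuous_powR.
rewrite /pow_law /density_law (_ : _ `&` _ = `[x, 1%R]%classic); last first.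
  apply/seteqP; split=> s /=; rewrite !in_itv/= andbT.
  - by move=> [-> /andP[_ ->]].
  - by move=> /andP[xs ->]; rewrite (le_trans (ltW x0) xs).
move: x1; rewrite le_eqVlt => /predU1P[->|x1].
  by rewrite set_itv1 integral_set1 powR1 subrr.
by rewrite (integral_is_derive x0 x1 (is_derive1_powR alpha) cf) powR1.
Qed.

Lemma pow_law_le0 : pow_law alpha `]-oo, 0%R[%classic = 0.
Proof.
rewrite /pow_law /density_law (_ : _ `&` _ = set0) ?integral_set0//.
apply/seteqP; split=> // s /=; rewrite !in_itv/= => -[s0 /andP[]].
by rewrite leNgt s0.
Qed.

Variables (n k : nat).
Hypothesis k1n : (1 <= k <= n)%N.

Lemma measurable_ku_density : measurable_fun setT (ku_density alpha n k).
Proof.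
apply: measurable_funM; first by apply: measurable_funM => //; exact: measurable_powR.
by apply: measurable_funX; apply: measurable_funB => //; exact: measurable_powR.
Qed.

(** With [u] the Pareto distribution function on [s > 1] and [H] the Bernstein tail, [H.[u s]] is an
    antiderivative of the density by the chain rule and [deriv_bernstein_tail]. *)
Lemma ku_mu_lt y : (1 < y)%R ->
  ku_mu alpha n k `]-oo, y[%classic =
  (\sum_(k <= j < (n + k).+1) 'C(n + k, j)%:R * (1 - y `^ (- alpha)) ^+ j
     * (y `^ (- alpha)) ^+ (n + k - j))%:E.
Proof.
move=> y1; pose H : {poly R} := (\sum_(k <= j < (n + k).+1)
  ('X^j * (1 - 'X) ^+ (n + k - j)) *+ 'C(n + k, j))%R.
pose u s : R := (1 - s `^ (- alpha))%R.
have HE t : H.[t] = (\sum_(k <= j < (n + k).+1)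
    'C(n + k, j)%:R * t ^+ j * (1 - t) ^+ (n + k - j))%R.
  rewrite horner_sum; apply: eq_bigr => j _.
  by rewrite hornerMn !hornerE -mulr_natl mulrA.
have cu (s : R) : (0 < s)%R -> {for s, continuous u}.
  move=> s0; apply: (@continuousB _ R^o R (cst 1%R)); first exact: cst_continuous.
  exact: continuous_powR.
have dF (s : R) : (0 < s)%R ->
    is_derive s 1%R (fun s : R => H.[u s]) (ku_density alpha n k s).
  move=> s0.
  have du : is_derive s 1%R u (alpha * s `^ (- alpha - 1))%R.
    have := is_deriveB (is_derive_cst (1%R : R) s 1%R) (is_derive1_powR (- alpha) s0).
    by rewrite sub0r mulNr opprK.
  have := @is_derive1_comp _ (horner H) u _ _ _ (is_derive_poly H (u s)) du.
  move=> /trigger_derive; apply.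
  rewrite /H deriv_bernstein_tail; last by rewrite leq_addl andbT; case/andP: k1n.
  rewrite hornerMn !hornerE subKr addnK /ku_density -/(u s).
  have -> : (s `^ (- alpha * n.+1%:R - 1))%R
      = ((s `^ (- alpha)) ^+ n * s `^ (- alpha - 1))%R.
    rewrite -powR_mulrn ?powR_ge0// -powRrM -powRD ?(gt_eqF s0) ?implybT//.
    by rewrite -natr1 mulrDr mulr1 addrA.
  (* The density uses ['C(n + k, n)] and the derivative ['C(n + k, k)]; they are equal by
     symmetry. *)
  rewrite -[in RHS](bin_sub (leq_addr k n)) addKn -mulr_natl natrM /=.
  ring.
have cf (s : R) : (0 < s)%R -> {for s, continuous (ku_density alpha n k)}.
  move=> s0; apply: (@continuousM _ R^o).
    apply: (@continuousM _ R^o (cst _)); first exact: cst_continuous.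
    exact: continuous_powR.
  exact: (@continuous_comp _ _ _ u (fun t => t ^+ k.-1)%R s (cu s s0)
    (@exprn_continuous R k.-1 (u s))).
have mE D : measurable_fun D (fun t => (ku_density alpha n k t)%:E).
  by apply/measurable_EFinP; apply: measurable_funTS; exact: measurable_ku_density.
rewrite /ku_mu /density_law ray_lt.
rewrite integral_itv_obnd_cbnd; last exact: mE.
rewrite integral_itv_bndo_bndc; last exact: mE.
(* This is the value at the lower end [s = 1], where [u] is 0: every term has a positive power
   [j >= k >= 1] of the variable. *)
have H0 : (H.[0] = 0)%R.
  rewrite HE big_nat_cond big1// => j /andP[/andP[kj _] _].
  by rewrite expr0n gtn_eqF ?mulr0 ?mul0r// (leq_trans _ kj)//; case/andP: k1n.
by rewrite (integral_is_derive ltr01 y1 dF cf) /u powR1 subrr H0 subr0 HE subKr.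
Qed.

Lemma ku_mu_le1 y : (y <= 1)%R -> ku_mu alpha n k `]-oo, y[%classic = 0.
Proof.
move=> y1; rewrite /ku_mu /density_law ray_lt set_itv_ge ?integral_set0//.
by rewrite bnd_simp -leNgt.
Qed.

Lemma ku_density_ge0 s : (1 < s)%R -> (0 <= ku_density alpha n k s)%R.
Proof.
move=> s1; rewrite /ku_density !mulr_ge0 ?powR_ge0 ?(ltW alpha_gt0)//.
rewrite exprn_ge0// subr_ge0 powRN invf_le1 ?powR_gt0 ?(lt_trans _ s1)//.
by rewrite -(powRr0 s) ler_powR// ltW.
Qed.

End PowerIntegrals.

(** * Measurability of order statistics, and the value expressed through a count *)

Section OrderStatistics.

(** By induction on the list: [k.+1] events occur when the first occurs with at least [k] of the
    others, or when at least [k.+1] of the others occur. *)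
Lemma measurable_count_ge d (S : measurableType d) (I : eqType)
    (e : I -> S -> bool) (s : seq I) (k : nat) :
  (forall i, i \in s -> measurable [set w | e i w]) ->
  measurable [set w | (k <= count (e ^~ w) s)%N].
Proof.
elim: s k => [|i s IH] k me.
  case: k => [|k].
    by rewrite (_ : [set _ | _] = setT)//; apply/seteqP; split.
  by rewrite (_ : [set _ | _] = set0)//; apply/seteqP; split.
case: k => [|k].
  by rewrite (_ : [set _ | _] = setT)//; apply/seteqP; split.
have mes j : j \in s -> measurable [set w | e j w].
  by move=> js; apply: me; rewrite inE js orbT.
rewrite (_ : [set _ | _] =
    ([set w | e i w] `&` [set w | (k <= count (e ^~ w) s)%N])
    `|` [set w | (k.+1 <= count (e ^~ w) s)%N]).
  apply: measurableU; last exact: IH.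
  by apply: measurableI; [apply: me; rewrite mem_head|exact: IH].
apply/seteqP; split=> w /=.
  by case: (e i w) => /=; [left|right].
case: (e i w) => /= -[[]//|] => // /leqW; by rewrite ltnS.
Qed.

Lemma measurable_count_eq d (S : measurableType d) (I : eqType)
    (e : I -> S -> bool) (s : seq I) (k : nat) :
  (forall i, i \in s -> measurable [set w | e i w]) ->
  measurable [set w | count (e ^~ w) s = k].
Proof.
move=> me; rewrite (_ : [set _ | _] = [set w | (k <= count (e ^~ w) s)%N] `\`
    [set w | (k.+1 <= count (e ^~ w) s)%N]).
  by apply: measurableD; exact: measurable_count_ge.
apply/seteqP; split=> w /=; first by move=> ->; split=> //; rewrite ltnn.
by move=> [kc /negP]; rewrite -leqNgt => ck; apply/eqP; rewrite eqn_leq kc ck.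
Qed.

Lemma measurable_lt_set d (S : measurableType d) (R : realType) (f g : S -> R) :
  measurable_fun setT f -> measurable_fun setT g -> measurable [set w | (f w < g w)%R].
Proof.
move=> mf mg; have := measurable_fun_ltr mf mg measurableT (Y := [set true]).
by rewrite setTI; apply.
Qed.

(** Preimages of open left rays are counting events, so sorting itself never has to be shown
    measurable. *)
Lemma measurable_order_stat d (S : measurableType d) (R : realType) (I : eqType)
    (f : I -> S -> R) (s : seq I) (k : nat) : (0 < k <= size s)%N ->
  (forall i, i \in s -> measurable_fun setT (f i)) ->
  measurable_fun setT (fun w => order_stat [seq f i w | i <- s] k).
Proof.
move=> ks mf; apply: (measurability _ (RGenInftyO.measurableE R)).
move=> _ [_ [y ->] <-]; rewrite setTI.
rewrite (_ : _ @^-1` _ =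
    [set w | (k <= count ((fun i w => (f i w < y)%R) ^~ w) s)%N]).
  apply: measurable_count_ge => i si; apply: measurable_lt_set => //.
  exact: mf.
by apply/seteqP; split=> w /=; rewrite in_itv/= order_stat_lt ?size_map// count_map.
Qed.

Lemma measurable_invr (R : realType) : measurable_fun [set: R] (@GRing.inv R).
Proof.
(* The squaring makes [`^ (-1)] agree with the inverse also at negative x. *)
rewrite (_ : @GRing.inv R = fun x => (x * (x ^+ 2) `^ (-1))%R).
  apply: measurable_funM => //; apply: (measurableT_comp (measurable_powR _)).
  exact: measurable_funX.
apply/funext => x; rewrite powR_inv1 ?sqr_ge0//.
have [->|x0] := eqVneq x 0%R; first by rewrite invr0 mul0r.
by rewrite expr2 invfM mulrA divff// mul1r.
Qed.

Context (R : realType) (n : nat).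
Implicit Types (Q : 'I_(2 * n) -> R) (W : 'I_n -> R).

(** The conventions at both ends fit the count, which lies between 0 and [n]: the case [k = 0]
    always holds and [k = n.+1] never does. *)
Lemma W_stat_ltE W (x : R) (k : nat) : (k <= n.+1)%N ->
  (W_stat W k < x%:E) = (k <= count (fun j => (W j < x)%R) (enum 'I_n))%N.
Proof.
move=> kn; have cn : (count (fun j => (W j < x)%R) (enum 'I_n) <= n)%N.
  by rewrite (leq_trans (count_size _ _))// size_enum_ord.
rewrite /W_stat; case: k kn => [|k] kn /=; first by rewrite ltNyr.
case: ifPn => [kn'|]; last first.
  by rewrite -ltnNge => nk; rewrite ltNge leey/= leqNgt ltnS (leq_trans cn).
rewrite lte_fin order_stat_lt; last by rewrite size_map size_enum_ord.
by rewrite count_map.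
Qed.

(** An interval open on the left and closed on the right says that the count is at least [k] and not
    at least [k.+1]. Ties between [x] and some [W j] are thus handled exactly. *)
Lemma W_stat_indic W (x : R) (k : nat) : (k <= n)%N ->
  \1_(`](W_stat W k), (W_stat W k.+1)]%classic : set (\bar R)) x%:E
  = (count (fun j => (W j < x)%R) (enum 'I_n) == k)%:R :> R.
Proof.
move=> kn; rewrite indicE; congr ((nat_of_bool _)%:R); apply/idP/idP.
  rewrite inE/= in_itv/= (W_stat_ltE _ _ (leqW kn)) => /andP[kc].
  by rewrite leNgt W_stat_ltE// -leqNgt => ck; rewrite eqn_leq kc ck.
move=> /eqP ck; rewrite inE/= in_itv/= (W_stat_ltE _ _ (leqW kn)) ck leqnn/=.
by rewrite leNgt W_stat_ltE// ck ltnn.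
Qed.

Lemma ku_value_sum (a b : R) Q W : ku_value a b Q W = (Num.max a b *
  \sum_(k < n.+1) Q_stat Q k (n + k) *
    (count (fun j => (W j < min_max_ratio a b)%R) (enum 'I_n) == k)%:R)%R.
Proof.
congr (_ * _)%R; apply: eq_bigr => k _; congr (_ * _)%R.
by rewrite W_stat_indic// -ltnS.
Qed.

Lemma ku_value_count (a b : R) Q W (k : nat) : (k <= n)%N ->
  count (fun j => (W j < min_max_ratio a b)%R) (enum 'I_n) = k ->
  ku_value a b Q W = (Num.max a b * Q_stat Q k (n + k))%R.
Proof.
move=> kn Wk; rewrite ku_value_sum Wk; congr (_ * _)%R.
rewrite (bigD1 (Ordinal (kn : k < n.+1)%N))//= eqxx mulr1 big1 ?addr0// => i ik.
by rewrite eq_sym (_ : _ == _ = false) ?mulr0//; apply/negbTE.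
Qed.

Lemma Q_statE Q k : (k <= n)%N -> Q_stat Q k (n + k) =
  if k == 0%N then 1%R
  else order_stat [seq Q i | i <- take (n + k) (enum 'I_(2 * n))] k.
Proof. by move=> kn; rewrite /Q_stat; case: eqP => // _; rewrite map_take. Qed.

Lemma size_take_enum k : (k <= n)%N ->
  size (take (n + k) (enum 'I_(2 * n))) = (n + k)%N.
Proof.
by move=> kn; rewrite size_takel// size_enum_ord mul2n -addnn leq_add2l.
Qed.

Lemma measurable_Q_stat d (S : measurableType d) (Q : 'I_(2 * n) -> S -> R) k :
  (k <= n)%N -> (forall i, measurable_fun setT (Q i)) ->
  measurable_fun setT (fun w => Q_stat (Q ^~ w) k (n + k)).
Proof.
move=> kn mQ; under eq_fun do rewrite Q_statE//.
case: eqP => [_|/eqP k0]; first exact: measurable_cst.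
apply: (measurable_order_stat (f := Q)) => //.
by rewrite size_take_enum// lt0n k0 leq_addl.
Qed.

(** Here [a] and [b] are arbitrary measurable functions, so that the lemma applies on the sample
    space and also on product spaces where one or both of them are constants or coordinates. *)
Lemma measurable_ku_value d (S : measurableType d) (a b : S -> R)
    (Q : 'I_(2 * n) -> S -> R) (W : 'I_n -> S -> R) :
  measurable_fun setT a -> measurable_fun setT b ->
  (forall i, measurable_fun setT (Q i)) -> (forall j, measurable_fun setT (W j)) ->
  measurable_fun setT (fun w => ku_value (a w) (b w) (Q ^~ w) (W ^~ w)).
Proof.
move=> ma mb mQ mW; under eq_fun do rewrite ku_value_sum.
apply: measurable_funM; first exact: measurable_maxr.
apply: measurable_sum => k; apply: measurable_funM.
  by apply: measurable_Q_stat => //; rewrite -ltnS.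
pose r w := min_max_ratio (a w) (b w).
have mr : measurable_fun setT r.
  apply: measurable_funM; first exact: measurable_minr.
  by apply: (measurableT_comp (@measurable_invr R)); exact: measurable_maxr.
rewrite (_ : (fun w => _) = \1_[set w |
    count ((fun j w => (W j w < r w)%R) ^~ w) (enum 'I_n) = k]).
  apply: measurable_indic; apply: measurable_count_eq => j _.
  exact: measurable_lt_set.
apply/funext => w; rewrite indicE; congr ((nat_of_bool _)%:R).
by apply/eqP/idP => [wk|]; rewrite inE.
Qed.

End OrderStatistics.

(** * Laws of counts and of Pareto order statistics *)

Section OrderStatisticLaws.
Context d (T : measurableType d) (R : realType) (P : probability T R).
Variables (I : finType) (X : I -> {RV P >-> R}).
Hypothesis indX : mutually_independent X.

Lemma prob_count_eq (s : seq I) (b : pred R) (p : R) (k : nat) :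
  uniq s -> measurable [set x | b x] ->
  (forall i, i \in s -> P (X i @^-1` [set x | b x]) = p%:E) ->
  P [set w | count (fun i => b (X i w)) s = k]
  = ('C(size s, k)%:R * p ^+ k * (1 - p) ^+ (size s - k))%:E.
Proof.
move=> us mb Pb; pose J := [set i in s]%SET.
have sJ : size s = #|J| by rewrite cardsE; apply/esym/card_uniqP.
rewrite sJ -(prob_card_eq indX (b := b))//; last first.
  by move=> i; rewrite inE; exact: Pb.
congr (P _); apply/funext => w /=; congr (_ = _).
rewrite -(count_map (X ^~ w) b) count_map_card//.
by apply: eq_card => i; rewrite !inE.
Qed.

Variable alpha : R.
Hypothesis alpha_gt0 : (0 < alpha)%R.

Lemma pow_prob_lt (i : I) (x : R) : has_law P (X i) (pow_law alpha) ->
  (0 <= x <= 1)%R -> P (X i @^-1` [set t | (t < x)%R]) = (x `^ alpha)%:E.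
Proof.
move=> [_ law] /andP[]; rewrite le_eqVlt => /predU1P[<- _|x0 x1].
  (* At [x = 0] both sides vanish, since [pow_law] has no mass below 0. The tail formula used
     afterwards needs [x] positive. *)
  rewrite powR0 ?gt_eqF// -[RHS](pow_law_le0 alpha) -law//=.
(* The density is unbounded at 0 when alpha < 1, hence the complement. *)
have := law `[x, +oo[%classic (measurable_itv _).
rewrite pow_law_ge ?x0//= /pushforward => Px.
rewrite (_ : [set t | _] = ~` `[x, +oo[%classic); last first.
  by apply/seteqP; split=> t /=; rewrite in_itv/= andbT ltNge => /negP.
rewrite -preimage_setC probability_setC; last first.
  by rewrite -[X in measurable X]setTI; exact: measurable_funP.
by rewrite Px -EFinB subKr.
Qed.

Lemma pareto_prob_lt (i : I) (y : R) : has_law P (X i) (pareto_law alpha) ->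
  P (X i @^-1` [set t | (t < y)%R])
  = (if (1 < y)%R then 1 - y `^ (- alpha) else 0)%:E.
Proof.
move=> [_ law]; have := law `]-oo, y[%classic (measurable_itv _).
rewrite /pushforward [in X in P X]set_itvE => ->.
by case: ltP => y1; [rewrite pareto_law_lt|rewrite pareto_law_le1].
Qed.

Lemma order_stat_pareto (n k : nat) (s : seq I) (A : set R) :
  (1 <= k <= n)%N -> uniq s -> size s = (n + k)%N ->
  (forall i, i \in s -> has_law P (X i) (pareto_law alpha)) ->
  measurable A ->
  P [set w | A (order_stat [seq X i w | i <- s] k)] = ku_mu alpha n k A.
Proof.
move=> k1n us sz law mA; have [k1 kn] := andP k1n.
have ks : (0 < k <= size s)%N by rewrite k1 sz leq_addl.
have mg : measurable_fun setT (fun w => order_stat [seq X i w | i <- s] k).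
  by apply: (measurable_order_stat (f := fun i w => X i w)).
pose g : {mfun T >-> R} := mfun_Sub (mem_set mg).
rewrite -[LHS]/(distribution P g A); apply: density_law_unique mA => //.
- by apply: measurable_funTS; exact: measurable_ku_density.
- by move=> x /=; rewrite in_itv/= andbT; exact: ku_density_ge0.
move=> y; pose p : R := if (1 < y)%R then (1 - y `^ (- alpha))%R else 0%R.
pose N w := count (fun i => (X i w < y)%R) s.
transitivity (P (\bigcup_(j in [set` index_iota k (n + k).+1]) [set w | N w = j])).
  congr (P _); apply/seteqP; split=> w /=.
    rewrite in_itv/= order_stat_lt ?size_map// count_map => kN.
    exists (N w) => //=; rewrite mem_index_iota kN ltnS -sz; exact: count_size.
  move=> [j /=]; rewrite mem_index_iota => /andP[kj _] Nj.
  by rewrite in_itv/= order_stat_lt ?size_map// count_map -/(N w) Nj.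
have mlt : measurable [set x : R | (x < y)%R] by exact: measurable_lt_set.
rewrite measure_fin_bigcup//=; last 2 first.
- by move=> i j _ _ [w [<- <-]].
- move=> j _; apply: measurable_count_eq => i _; exact: measurable_lt_set.
rewrite -fsbig_seq ?iota_uniq//.
under eq_bigr => j _.
  rewrite (prob_count_eq (b := fun x => (x < y)%R) (p := p))// => [|i si]; last first.
    exact/pareto_prob_lt/law.
  over.
rewrite sumEFin sz /p; case: ltP => y1.
  by rewrite subKr; apply/esym/ku_mu_lt.
rewrite [RHS]ku_mu_le1// big_nat_cond big1// => j /andP[/andP[kj _] _].
by rewrite expr0n gtn_eqF ?mulr0 ?mul0r// (leq_trans k1).
Qed.

End OrderStatisticLaws.

(** * The law of the value for fixed thetas *)

Definition ku_index (n : nat) : finType := (bool + ('I_(2 * n) + 'I_n))%type.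

Section KuDelta.
Context (R : realType) (alpha : R) (n : nat) d (T : measurableType d)
  (P : probability T R) (theta1 theta2 : {RV P >-> R})
  (Q : 'I_(2 * n) -> {RV P >-> R}) (W : 'I_n -> {RV P >-> R}).
Hypothesis alpha_gt0 : (0 < alpha)%R.
Hypothesis Q_law : forall i, has_law P (Q i) (pareto_law alpha).
Hypothesis W_law : forall j, has_law P (W j) (pow_law alpha).
Let X : ku_index n -> {RV P >-> R} := ku_family theta1 theta2 Q W.
Hypothesis indX : mutually_independent X.
Let iQ (i : 'I_(2 * n)) : ku_index n := inr (inl i).
Let iW (j : 'I_n) : ku_index n := inr (inr j).
Let KQ := [set i : ku_index n | if i is inr (inl _) then true else false]%SET.
Let KW := [set i : ku_index n | if i is inr (inr _) then true else false]%SET.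

(** The event is split by the count [N]. The condition [N w = k] involves only the [W j] and [B k]
    only the [Q i], so each probability factors into a binomial weight and a value of [ku_mu], which
    is the summand of [ku_delta1]. *)
Lemma ku_delta_law (a b : R) (A : set R) : (0 <= a)%R -> (0 <= b)%R ->
  measurable A ->
  P [set w | A (ku_value a b (fun i => Q i w) (fun j => W j w))]
  = ku_delta alpha n a b A.
Proof.
move=> a0 b0 mA; rewrite /ku_delta.
have M0 : (0 <= Num.max a b)%R by rewrite le_max a0.
case: ifPn => [Mpos|]; last first.
  (* In the degenerate case both arguments are 0, the value is identically 0 and its law is the
     Dirac mass at 0. *)
  rewrite -leNgt => M_le0; have M_eq0 : Num.max a b = 0%R by apply/le_anti/andP.
  rewrite diracE (_ : [set w | _] = [set w | A 0%R]); last first.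
    by apply/funext => w /=; rewrite /ku_value M_eq0 mul0r.
  have [A0|A0] := boolP (0%R \in A).
    rewrite (_ : [set _ | _] = setT) ?probability_setT//.
    by apply/seteqP; split=> // w _; exact: set_mem.
  rewrite (_ : [set _ | _] = set0) ?measure0//.
  by apply/seteqP; split=> // w /= /mem_set; exact/negP.
set M := Num.max a b in Mpos *; set x := (Num.min a b / M)%R.
have x01 : (0 <= x <= 1)%R.
  rewrite divr_ge0 ?le_min ?a0//= ler_pdivrMr// mul1r.
  by rewrite /M le_max ge_min lexx.
pose p := (x `^ alpha)%R.
pose N w := count (fun j => (W j w < x)%R) (enum 'I_n).
pose B k := [set w | A (M * Q_stat (Q ^~ w) k (n + k))%R].
have Nn w : (N w <= n)%N by rewrite (leq_trans (count_size _ _))// size_enum_ord.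
(* Measurability is proved in the smaller sigma-algebras of [KW] and [KQ], as the independence
   argument requires. *)
have mNk k : measurable ([set w | N w = k] : set (cylinderType X KW)).
  apply: measurable_count_eq => j _; apply: measurable_lt_set => //.
  by apply: (@cylinder_measurable_fun _ _ _ _ _ X KW (iW j)); rewrite inE.
have mB k : (k <= n)%N -> measurable (B k : set (cylinderType X KQ)).
  move=> kn; have mMQ : measurable_fun [set: cylinderType X KQ]
      (fun w => M * Q_stat (Q ^~ w) k (n + k))%R.
    apply: measurable_funM => //.
    apply: (@measurable_Q_stat _ _ _ (cylinderType X KQ) (fun i w => Q i w)) => // i.
    by apply: (@cylinder_measurable_fun _ _ _ _ _ X KQ (iQ i)); rewrite inE.
  by have := mMQ measurableT A mA; rewrite setTI.
have PN k : P [set w | N w = k] = ('C(n, k)%:R * p ^+ k * (1 - p) ^+ (n - k))%:E.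
  have := prob_count_eq indX (s := [seq iW j | j <- enum 'I_n])
    (b := fun t => (t < x)%R) (p := p) k.
  rewrite size_map size_enum_ord => <-.
  - by congr (P _); apply/funext => w /=; rewrite count_map.
  - by rewrite map_inj_uniq ?enum_uniq// => ? ? [].
  - exact: measurable_lt_set.
  - by move=> _ /mapP[j _ ->]; exact: (pow_prob_lt (X := X) (i := iW j) alpha_gt0 (W_law j) x01).
have PB k : (1 <= k <= n)%N -> P (B k) = ku_mu alpha n k ((fun t => M * t)%R @^-1` A).
  move=> k1n; have [k1 kn] := andP k1n.
  rewrite -(order_stat_pareto indX alpha_gt0 k1n
    (s := [seq iQ i | i <- take (n + k) (enum 'I_(2 * n))])).
  - congr (P _); apply/funext => w; rewrite /B /= Q_statE// gtn_eqF//.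
    by rewrite -map_comp.
  - by rewrite map_inj_uniq ?take_uniq ?enum_uniq// => ? ? [].
  - by rewrite size_map size_take_enum.
  - by move=> _ /mapP[i _ ->]; exact: Q_law.
  - rewrite -[X in measurable X]setTI; exact: measurable_funM.
transitivity (P (\bigcup_(k in [set` index_iota 0 n.+1])
    ([set w | N w = k] `&` B k))).
  congr (P _); apply/seteqP; split=> w /=.
    move=> Aw; exists (N w); first by rewrite /= mem_index_iota ltnS Nn.
    by split=> //; rewrite /B /= -(ku_value_count (a := a) (b := b) _ (Nn w) (erefl _)).
  move=> [k /=]; rewrite mem_index_iota ltnS => kn [Nk].
  by rewrite /B /= -(ku_value_count (a := a) (b := b) _ kn Nk).
have kn k : k \in index_iota 0 n.+1 -> (k <= n)%N by rewrite mem_index_iota ltnS.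
rewrite measure_fin_bigcup//=; last 2 first.
- by move=> i j _ _ [w [[<- _] [<- _]]].
- move=> k /kn ?; apply: measurableI.
    exact: (cylinder_sub (mNk k)).
  by apply: (cylinder_sub (mB k _)).
rewrite -fsbig_seq ?iota_uniq//.
rewrite (eq_big_seq (fun k => P [set w | N w = k] * P (B k))); last first.
  move=> k /kn ?; rewrite setIC muleC.
  apply: (indep_cylinders indX _ (mB k _) (mNk k)) => //.
  by rewrite -setI_eq0; apply/eqP/setP => -[?|[?|?]]; rewrite !inE.
(* The term [k = 0] is the Dirac part: [Q_stat] is then the constant 1, so [B 0] is the whole space
   or empty. *)
rewrite big_ltn// /pushforward /ku_delta1; congr (_ + _).
  rewrite PN bin0 expr0 !mul1r subn0; congr (_ * _).
  rewrite diracE /B; have [A0|A0] := boolP (1%R \in (fun t => M * t)%R @^-1` A).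
    rewrite (_ : [set _ | _] = setT) ?probability_setT//.
    apply/seteqP; split=> // w _; exact: set_mem A0.
  rewrite (_ : [set _ | _] = set0) ?measure0//.
  by apply/seteqP; split=> // w /= /mem_set; exact/negP.
apply: eq_big_nat => k; rewrite ltnS => k1n.
by rewrite PN PB// powRrM powR_mulrn ?powR_ge0.
Qed.

End KuDelta.

(** * Integration over the laws of [theta1] and [theta2] *)

Theorem theorem8 (R : realType) (alpha : R) (n : nat)
    (alpha_gt0 : (0 < alpha)%R) (n_ge1 : (1 <= n)%N)
    (mu1 mu2 : probability R R)
    (mu1_nonneg : nonneg_law mu1) (mu2_nonneg : nonneg_law mu2)
    (d : measure_display) (T : measurableType d) (P : probability T R)
    (theta1 theta2 : {RV P >-> R})
    (Q : 'I_(2 * n) -> {RV P >-> R}) (W : 'I_n -> {RV P >-> R})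
    (theta1_law : has_law P theta1 mu1) (theta2_law : has_law P theta2 mu2)
    (Q_law : forall i, has_law P (Q i) (pareto_law alpha))
    (W_law : forall j, has_law P (W j) (pow_law alpha))
    (indep : mutually_independent (ku_family theta1 theta2 Q W)) :
  has_law P
    (fun w => ku_value (theta1 w) (theta2 w) (fun i => Q i w) (fun j => W j w))
    (ku_conv alpha n mu1 mu2).
Proof.
split; first exact: (measurable_ku_value (Q := Q) (W := W)).
move=> A mA; pose X : ku_index n -> {RV P >-> R} := ku_family theta1 theta2 Q W.
pose i1 : ku_index n := inl false.
pose i2 : ku_index n := inl true.
(* [K1] keeps everything but [theta1], because [theta2] is still random when [theta1] is frozen;
   [K2] keeps only the [Q i] and [W j]. *)
pose K1 := [set~ i1]%SET.
pose K2 := [set i : ku_index n | if i is inr _ then true else false]%SET.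
pose h a b w := ku_value a b (Q ^~ w) (W ^~ w).
have m1 i : i != i1 -> measurable_fun setT (X i : cylinderType X K1 -> R).
  by move=> ii1; apply: cylinder_measurable_fun; rewrite !inE.
have mh1 : measurable_fun [set: R * cylinderType X K1]
    (fun z => h z.1 (theta2 z.2) z.2).
  apply: (@measurable_ku_value R n _ (R * cylinderType X K1)%type fst
    (fun z => theta2 z.2) (fun i z => Q i z.2) (fun j z => W j z.2)) => //.
  - by apply: (measurableT_comp (m1 i2 _)).
  - by move=> i; apply: (measurableT_comp (m1 (inr (inl i)) _)).
  - by move=> j; apply: (measurableT_comp (m1 (inr (inr j)) _)).
have m2 i : measurable_fun setT (X (inr i) : cylinderType X K2 -> R).
  by apply: cylinder_measurable_fun; rewrite inE.
have mh2 a : measurable_fun [set: R * cylinderType X K2] (fun z => h a z.1 z.2).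
  apply: (@measurable_ku_value R n _ (R * cylinderType X K2)%type (cst a)
    fst (fun i z => Q i z.2) (fun j z => W j z.2)) => //.
  - by move=> i; apply: (measurableT_comp (m2 (inl i))).
  - by move=> j; apply: (measurableT_comp (m2 (inr j))).
pose C1 : set (R * cylinderType X K1) := (fun z => h z.1 (theta2 z.2) z.2) @^-1` A.
pose C2 a : set (R * cylinderType X K2) := (fun z => h a z.1 z.2) @^-1` A.
have mC1 : measurable C1 by rewrite -[C1]setTI; exact: mh1.
have mC2 a : measurable (C2 a) by rewrite -[C2 a]setTI; exact: mh2.
have i1K1 : i1 \notin K1 by rewrite !inE.
have i2K2 : i2 \notin K2 by rewrite inE.
have [mF1 F1] := fubini_cylinders indep i1K1 theta1_law mC1.
have F2 a := fubini_cylinders indep i2K2 theta2_law (mC2 a).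
(* The negative half-line is negligible for both laws, which brings the Fubini integrals to the
   domain [[0, +oo[] used in [ku_conv]. *)
have nonneg (mu : probability R R) (f : R -> \bar R) : nonneg_law mu ->
    measurable_fun setT f -> (forall x, 0 <= f x) ->
    \int[mu]_x f x = \int[mu]_(x in `[0%R, +oo[) f x.
  move=> mu0 mf f0; rewrite (ge0_negligible_integral (measurable_itv `]-oo, 0%R[))//.
  by rewrite setTD setCitvl.
rewrite /pushforward -[LHS]/(P [set w | C1 (X i1 w, w)]) F1 nonneg//.
rewrite /ku_conv; apply: eq_integral => a; rewrite inE/= in_itv/= andbT => a0.
have [mF2 {}F2] := F2 a.
rewrite -[LHS]/(P [set w | C2 a (X i2 w, w)]) F2 nonneg//.
apply: eq_integral => b; rewrite inE/= in_itv/= andbT => b0.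
exact: (ku_delta_law alpha_gt0 Q_law W_law indep).
Qed.
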